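(* Let $\sigma:[0,1]^{\mathbb{Z}}\to[0,1]^{\mathbb{Z}}$ be the left shift, and equip $[0,1]^{\mathbb{Z}}$ with the metric $d^{\mathbb{Z}}(x,y)=\sum_{n\in\mathbb{Z}}\frac{|x_n-y_n|}{2^{|n|}}$. Then for every $\sigma$-invariant Borel probability measure $\mu$ on $[0,1]^{\mathbb{Z}}$, $$\underline{\mathrm{MRID}}([0,1]^{\mathbb{Z}},\sigma,d^{\mathbb{Z}},\mu)=\underline{d}(\mu),\qquad \overline{\mathrm{MRID}}([0,1]^{\mathbb{Z}},\sigma,d^{\mathbb{Z}},\mu)=\overline{d}(\mu),$$ where $\underline{\mathrm{MRID}},\overline{\mathrm{MRID}}$ are the lower and upper mean Rényi information dimensions of $\mu$ and $\underline{d}(\mu),\overline{d}(\mu)$ are the lower and upper information dimension rates of $\mu$.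
   Context: Logarithms are natural; $0\cdot\infty=0$. The left shift is $\sigma((x_n)_{n})=(x_{n+1})_{n}$. Entropy of partitions. Let $X$ be a compact metrizable space, $T:X\to X$ a homeomorphism, and $\mu$ a $T$-invariant Borel probability measure. For a Borel measurable partition $\alpha$ of $X$ (not necessarily finite), $H_\mu(\alpha)=\sum_{A\in\alpha}-\mu(A)\log\mu(A)$. Let $\alpha^n=\bigvee_{j=0}^{n-1}T^{-j}\alpha$ be the join, where $\alpha\vee\beta=\{A\cap B:A\in\alpha,B\in\beta\}$. If $H_\mu(\alpha^n)=\infty$ for some $n$, put $h_\mu(T,\alpha)=\infty$; otherwise $h_\mu(T,\alpha)=\limsup_{n\to\infty}\frac1n H_\mu(\alpha^n)$. Mean Rényi information dimensions. For a compatible metric $d$ on $X$ and a partition $\alpha$, let $\mathrm{diam}(\alpha)=\sup_{A\in\alpha}\mathrm{diam}(A,d)$. Then $$\underline{\mathrm{MRID}}(X,T,d,\mu)=\liminf_{\epsilon\to0}\frac{1}{\log\frac1\epsilon}\inf_{\mathrm{diam}(\alpha)\le\epsilon}h_\mu(T,\alpha),\qquad \overline{\mathrm{MRID}}(X,T,d,\mu)=\limsup_{\epsilon\to0}\frac{1}{\log\frac1\epsilon}\inf_{\mathrm{diam}(\alpha)\le\epsilon}h_\mu(T,\alpha),$$ where the infimum is over all Borel measurable partitions $\alpha$ of $X$ with diameter at most $\epsilon$. Information dimension rates. For an integer $m\ge1$ let $\alpha_m=\pi^{-1}(\{[\frac im,\frac{i+1}m)\cap[0,1]:i\in\mathbb{Z}\})$,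 a finite partition of $[0,1]^{\mathbb{Z}}$, where $\pi:[0,1]^{\mathbb{Z}}\to[0,1]$ is the projection to the $0$-th coordinate. Then $$\underline d(\mu)=\liminf_{m\to\infty}\frac{h_\mu(\sigma,\alpha_m)}{\log m},\qquad \overline d(\mu)=\limsup_{m\to\infty}\frac{h_\mu(\sigma,\alpha_m)}{\log m}.$$
   Formalization: Borel partitions are taken to be countable: if uncountable ones were allowed, the partition into points would have diameter 0 and entropy 0 for every atomless measure, and the equality would fail, for instance for the product of Lebesgue measures. *)

(* Defs.v *)
From HB Require Import structures.
From mathcomp Require Import all_boot all_order all_algebra.
From mathcomp Require Import all_classical all_reals all_analysis.
From mathcomp Require Import lra.

Set Implicit Arguments.
Unset Strict Implicit.
Unset Printing Implicit Defensive.

Import Order.TTheory GRing.Theory Num.Theory.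
Import numFieldNormedType.Exports.

Local Open Scope classical_set_scope.
Local Open Scope ring_scope.

(* Developed in MathComp-Analysis, over an arbitrary model R of the reals.    *)

Notation borel X := (g_sigma_algebraType (@open X)).

Section Entropy.
Context {R : realType} {X : ptopologicalType}.
Implicit Types (T : X -> X) (mu : probability (borel X) R).
Implicit Types (d : X -> X -> R) (alpha beta : set (set X)).

Definition invariant_measure T mu : Prop :=
  forall A : set (borel X), measurable A -> mu (T @^-1` A) = mu A.

(* A partition is the set of its cells. The empty set is allowed as a cell    *)
(* (it arises in joins and contributes nothing to the entropy). Partitions    *)
(* are countable: with uncountably many cells, the partition into points      *)
(* would have zero entropy for every atomless measure.                        *)
Definition borel_partition alpha : Prop :=
  [/\ countable alpha,
      forall A, alpha A -> measurable (A : set (borel X)),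
      trivIset alpha id
    & cover alpha id = [set: X]].

(* lne 0 = -oo and 0 * -oo = 0 in \bar R; the terms are nonnegative, and esum *)
(* is the unordered sum of nonnegative terms.                                 *)
Definition entropy mu alpha : \bar R :=
  (\esum_(A in alpha) - (mu A * lne (mu A)))%E.

Definition pjoin alpha beta : set (set X) :=
  [set A `&` B | A in alpha & B in beta].

Definition preim_part T j alpha : set (set X) :=
  [set iter j T @^-1` A | A in alpha].

Definition part_iter T alpha n : set (set X) :=
  \big[pjoin/[set setT]]_(j < n) preim_part T j alpha.

Definition entropy_rate T mu alpha : \bar R :=
  if `[< exists n, entropy mu (part_iter T alpha n) = +oo%E >] then +oo%E
  else limn_esup (fun n => ((n%:R^-1)%:E * entropy mu (part_iter T alpha n))%E).

(* In \bar R, the diameter of the empty set is -oo.                           *)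
Definition diam d (A : set X) : \bar R :=
  ereal_sup [set (d x y)%:E | x in A & y in A].

Definition part_diam d alpha : \bar R := ereal_sup (diam d @` alpha).

Definition inf_entropy_rate T d mu (eps : R) : \bar R :=
  ereal_inf [set entropy_rate T mu alpha | alpha in
    [set alpha | borel_partition alpha /\ (part_diam d alpha <= eps%:E)%E]].

Definition lower_mrid T d mu : \bar R :=
  limf_einf (fun eps : R =>
    (((ln eps^-1)^-1)%:E * inf_entropy_rate T d mu eps)%E) 0^'+.

Definition upper_mrid T d mu : \bar R :=
  limf_esup (fun eps : R =>
    (((ln eps^-1)^-1)%:E * inf_entropy_rate T d mu eps)%E) 0^'+.

End Entropy.

Section UnitSequences.
Context {R : realType}.

Definition unit_itv : Type := set_type [set` `[0 : R, 1]].
HB.instance Definition _ :=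
  Topological.copy unit_itv (set_type [set` `[0 : R, 1]]).

Fact unit_itv0 : (0 : R) \in [set` `[0 : R, 1]].
Proof. by rewrite mem_setE in_itv /= lexx ler01. Qed.
HB.instance Definition _ := isPointed.Build unit_itv (exist _ 0 unit_itv0).

End UnitSequences.
Arguments unit_itv : clear implicits.

Definition unit_seq (R : realType) : Type := {ptws int -> unit_itv R}.
HB.instance Definition _ (R : realType) :=
  Topological.copy (unit_seq R) {ptws int -> unit_itv R}.
HB.instance Definition _ (R : realType) :=
  isPointed.Build (unit_seq R) (fun=> point).

Section InformationDimensionRate.
Context {R : realType}.
Implicit Types (mu : probability (borel (unit_seq R)) R) (x y : unit_seq R).

Definition left_shift x : unit_seq R := fun n => x (n + 1).

Definition unit_coord x (n : int) : R := val (x n).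

Definition distZ_series x y : \bar R :=
  (\esum_(n in [set: int])
     (`|unit_coord x n - unit_coord y n| / 2 ^+ absz n)%:E)%E.

Lemma distZ_series_lty x y : (distZ_series x y < +oo)%E.
Proof.
pose a (n : int) := (`|unit_coord x n - unit_coord y n| / 2 ^+ absz n)%:E.
have a0 n : (0 <= a n)%E by rewrite lee_fin divr_ge0 ?exprn_ge0.
have aup n : (a n <= (2 / (2 ^ (absz n + 1))%:R)%:E)%E.
  rewrite lee_fin addn1 natrX exprS invfM mulrA divff ?pnatr_eq0//.
  rewrite ler_wpM2r ?invr_ge0 ?exprn_ge0//.
  have I z k : 0 <= unit_coord z k <= 1.
    rewrite /unit_coord; case: (z k) => t /=; rewrite inE /= => tI.
    by move: tI; rewrite in_itv.
  by rewrite ler_distl; have := I x n; have := I y n; lra.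
have bound (e : nat -> int) (inj : injective e) :
    (forall n, (n <= absz (e n))%N) ->
    (\esum_(i in range e) a i < +oo)%E.
  move=> le; rewrite esum_image; last by move=> ? ? _ _; exact: inj.
  apply: (@le_lt_trans _ _ (\esum_(n in [set: nat])
    (2 / (2 ^ (n + 1))%:R)%:E)%E).
    apply: le_esum => n _; apply: le_trans (aup _) _.
    rewrite lee_fin ler_pM2l// lef_pV2 ?posrE ?ltr0n ?expn_gt0//.
    by rewrite ler_nat leq_pexp2l// leq_add2r.
  rewrite -nneseries_esumT; last by move=> n; rewrite lee_fin divr_ge0.
  by have /cvg_lim -> := @cvg_geometric_eseries_half R 2 0; rewrite ?ltry.
rewrite /distZ_series (esumID (range Posz)) // !setTI.
rewrite lte_add_pinfty ?bound//; first by move=> ? ? [].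
suff -> : ~` range Posz = range Negz by apply: bound => // ? ? [].
apply/seteqP; split=> [[n|n] //= | _ [n _ <-] [m _]//].
- by move=> h; exfalso; apply: h; exists n.
- by move=> _; exists n.
Qed.

Definition distZ x y : R := fine (distZ_series x y).

Definition cylinder_part (m : nat) : set (set (unit_seq R)) :=
  [set unit_coord^~ 0 @^-1` `[i%:~R / m%:R, (i + 1)%:~R / m%:R[
    | i in [set: int]].

(* ln m = 0 for m = 0, 1, which is irrelevant to the limits in m.            *)
Definition lower_idr mu : \bar R :=
  limn_einf (fun m =>
    (entropy_rate left_shift mu (cylinder_part m) * ((ln m%:R)^-1)%:E)%E).

Definition upper_idr mu : \bar R :=
  limn_esup (fun m =>
    (entropy_rate left_shift mu (cylinder_part m) * ((ln m%:R)^-1)%:E)%E).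

End InformationDimensionRate.

(* Main.v *)
Require Import Defs.
From mathcomp Require Import all_boot all_order all_algebra.
From mathcomp Require Import all_classical all_reals all_analysis.
From mathcomp Require Import ring lra zify.

(* A cell of diameter at most [eps] meets at most three cells of [alpha_m] when
   [m eps <= 1], so a cell of [alpha^n] meets at most [3^n] cells of [alpha_m^n]
   and [h(alpha_m) <= h(alpha) + ln 3]. Conversely, the join of
   [sigma^j alpha_m] over [|j| <= L] has diameter at most [eps] when
   [8 <= m eps] and [L] is large, and its [n]-th iterate is coarser than a
   translate of [alpha_m^(n + 2 L + 1)], so it has the entropy rate of [alpha_m]
   at most. With [m] comparable to [1 / eps], the two logarithms differ by a
   bounded amount and the limits agree. *)

Set Implicit Arguments.
Unset Strict Implicit.
Unset Printing Implicit Defensive.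

Import Order.TTheory GRing.Theory Num.Theory.
Import numFieldNormedType.Exports.

Local Open Scope classical_set_scope.
Local Open Scope ring_scope.

(** * Comparison of upper and lower limits along two filters *)

Section LimitComparison.
Context {R : realType} {T S : topologicalType}.
Context (F : set_system T) (G : set_system S).
Context (u : T -> \bar R) (v : S -> \bar R).
Context {FF : Filter F} {FG : Filter G}.
Local Open Scope ereal_scope.

(** The error $(1+d)v+d$ absorbs a change of normalising factor together with a bounded additive
    gap. It vanishes in the limit: under a finite bound $r$ on $v$ it costs at most $d(1+|r|)$. *)
Lemma le_limf_esup (phi : T -> S) : phi @ F --> G ->
  (forall d : R, (0 < d)%R ->
    \forall t \near F, u t <= (1 + d)%:E * v (phi t) + d%:E) ->
  limf_esup u F <= limf_esup v G.
Proof.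
move=> phiFG uv; apply: le_ereal_inf_tmp => _ [V GV <-].
set s := ereal_sup _.
have key (d : R) (y : \bar R) : (0 < d)%R ->
    (forall t, v (phi t) <= s -> u t <= (1 + d)%:E * v (phi t) + d%:E ->
      u t <= y) -> limf_esup u F <= y.
  move=> d0 uy.
  pose W := (phi @^-1` V) `&` [set t | u t <= (1 + d)%:E * v (phi t) + d%:E].
  have FW : F W by apply: filterI; [exact: phiFG|exact: uv].
  apply: (@le_trans _ _ (ereal_sup (u @` W))).
    by apply: ereal_inf_lbound; exists W.
  apply: ge_ereal_sup => _ [t [Vt ut] <-]; apply: uy ut.
  by apply: ereal_sup_ubound; exists (phi t).
case sE : s => [r| |]; rewrite sE in key.
- apply/lee_addgt0Pr => e e0.
  have r1 : (0 < 1 + `|r|)%R by rewrite ltr_pwDl.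
  have d0 : (0 < e / (1 + `|r|))%R by rewrite divr_gt0.
  apply: (key _ _ d0) => t vr /le_trans; apply.
  set d := (e / (1 + `|r|))%R in d0 *.
  apply: (@le_trans _ _ ((1 + d)%:E * r%:E + d%:E)).
    by rewrite leeD2r// lee_wpmul2l// lee_fin addr_ge0// ltW.
  rewrite -EFinM -!EFinD lee_fin mulrDl mul1r -addrA lerD2l.
  have -> : e = (d * (1 + `|r|))%R by rewrite divfK// gt_eqF.
  rewrite mulrDr mulr1 addrC lerD2l ler_pM2l//; exact: ler_norm.
- by rewrite leey.
- apply: (key 1%R) => // t; rewrite leeNy_eq => /eqP ->.
  by rewrite gt0_muleNy// lte_fin ltr_pwDl.
Qed.

(** Dual form. A lower bound of [u] on [V] is transported to [v], so the change of variable runs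
    from [S] to [T], opposite to the case of upper limits. *)
Lemma le_limf_einf (psi : S -> T) : psi @ G --> F ->
  (forall d : R, (0 < d)%R ->
    \forall s \near G, u (psi s) <= (1 + d)%:E * v s + d%:E) ->
  limf_einf u F <= limf_einf v G.
Proof.
move=> psiGF uv; rewrite !limf_einfE; apply: ge_ereal_sup => _ [V FV <-].
set s := ereal_inf _; set L := ereal_sup _.
have key (d : R) (y : \bar R) : (0 < d)%R ->
    (forall t, s <= u (psi t) -> u (psi t) <= (1 + d)%:E * v t + d%:E ->
      y <= v t) -> y <= L.
  move=> d0 uy.
  pose W := (psi @^-1` V) `&` [set t | u (psi t) <= (1 + d)%:E * v t + d%:E].
  have GW : G W by apply: filterI; [exact: psiGF|exact: uv].
  apply: (@le_trans _ _ (ereal_inf (v @` W))); last first.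
    by apply: ereal_sup_ubound; exists W.
  apply: le_ereal_inf_tmp => _ [t [Vt ut] <-]; apply: uy ut.
  by apply: ereal_inf_lbound; exists (psi t).
case sE : s => [r| |]; rewrite sE in key.
- apply/lee_addgt0Pr => e e0.
  have r1 : (0 < 1 + `|r|)%R by rewrite ltr_pwDl.
  have d0 : (0 < e / (1 + `|r|))%R by rewrite divr_gt0.
  rewrite -leeBlDr//; apply: (key _ _ d0) => t /le_trans /[apply].
  set d := (e / (1 + `|r|))%R in d0 *.
  have eE : e = (d * (1 + `|r|))%R by rewrite divfK// gt_eqF.
  have d1 : (0 < 1 + d)%R by rewrite addr_gt0.
  case: (v t) => [x| |]; [|by rewrite leey|]; last first.
    by rewrite gt0_muleNy ?lte_fin// addNye leeNy_eq.
  rewrite -EFinM -!EFinD !lee_fin => h.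
  (* After multiplication by $1+d$ it remains to see $(1+d)(r-e)\le r-d$, which follows from
     $e=d(1+|r|)$. *)
  rewrite -(ler_pM2l d1); apply: le_trans (_ : (r - d <= _)%R); last by rewrite lerBlDr.
  have h1 : (d * r <= d * `|r|)%R by rewrite ler_pM2l// ler_norm.
  have h2 : (0 <= d * e)%R by rewrite mulr_ge0// ltW.
  rewrite eE in h2 *; lra.
- apply: (key 1%R) => // t /le_trans /[apply].
  case: (v t) => [x| |]; rewrite ?leey//.
  by rewrite gt0_muleNy ?lte_fin ?addr_gt0// addNye leeNy_eq.
- by rewrite leNye.
Qed.

End LimitComparison.

Lemma limn_esup_le_addr {R : realType} (u v : nat -> \bar R) (c : R) :
  (forall n, u n <= v n + c%:E)%E -> (limn_esup u <= limn_esup v + c%:E)%E.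
Proof.
move=> uv; rewrite -leeBlDr//; apply: le_ereal_inf_tmp => _ [V ooV <-].
rewrite leeBlDr//; apply: (@le_trans _ _ (ereal_sup (u @` V))).
  by apply: ereal_inf_lbound; exists V.
apply: ge_ereal_sup => _ [n Vn <-]; apply: le_trans (uv n) _.
by rewrite leeD2r//; apply: ereal_sup_ubound; exists n.
Qed.

(** As $C\le ad$, one has $b\le a+C\le(1+d)a$, so $1/a\le(1+d)/b$, while $C/a\le d$. This serves
    both for the time shift from $n$ to $n+K$ and for the logarithms of $m$ and $1/\epsilon$. *)
Lemma scaled_le {R : realType} (a b C d : R) (g h : \bar R) :
  0 < d -> 0 < C -> C / d <= a -> 0 < b -> b <= a + C ->
  (0 <= g)%E -> (h <= g + C%:E)%E ->
  ((a^-1)%:E * h <= (1 + d)%:E * ((b^-1)%:E * g) + d%:E)%E.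
Proof.
move=> d0 C0 Ca b0 ba g0 hg.
have a0 : 0 < a by apply: lt_le_trans Ca; rewrite divr_gt0.
have Cda : C <= a * d by rewrite -ler_pdivrMr.
apply: (@le_trans _ _ ((a^-1)%:E * (g + C%:E))%E).
  by rewrite lee_wpmul2l// lee_fin invr_ge0 ltW.
rewrite ge0_muleDr ?lee_fin ?(ltW C0)//. rewrite leeD//.
  rewrite muleA -EFinM lee_wpmul2r// lee_fin.
  rewrite ler_pdivlMr// mulrC ler_pdivrMr//; lra.
by rewrite -EFinM lee_fin mulrC ler_pdivrMr// mulrC.
Qed.

(** * The function $-x\ln x$ *)

Section EntropyTerm.
Context {R : realType}.
Local Open Scope ereal_scope.

Definition entropy_term (x : \bar R) : \bar R := - (x * lne x).

Lemma entropy_term_EFin (p : R) : (0 <= p)%R ->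
  entropy_term p%:E = (p * - ln p)%:E.
Proof.
rewrite /entropy_term le_eqVlt => /predU1P[<-|p0].
  by rewrite mul0e mul0r oppe0.
by rewrite lne_EFin// -EFinM -EFinN mulrN.
Qed.

Lemma entropy_term_ge0 (p : R) : (0 <= p <= 1)%R -> 0 <= entropy_term p%:E.
Proof.
move=> /andP[p0 p1]; rewrite entropy_term_EFin// lee_fin mulr_ge0// oppr_ge0.
exact: ln_le0.
Qed.

(** Monotonicity of the logarithm; summed over the pieces of a cell of mass [p], this gives
    subadditivity of the entropy terms. *)
Lemma entropy_term_lower (p q : R) : (0 <= q)%R -> (q <= p)%R ->
  (q * - ln p)%:E <= entropy_term q%:E.
Proof.
move=> q0 qp; rewrite entropy_term_EFin// lee_fin.
move: q0; rewrite le_eqVlt => /predU1P[<-|q0]; first by rewrite !mul0r.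
by rewrite ler_pM2l// lerN2 ler_ln// posrE (lt_le_trans q0).
Qed.

(* [ln t <= t - 1] at [t = r / q] *)
Lemma entropy_term_tangent (q r : R) : (0 <= q)%R -> (0 < r)%R ->
  entropy_term q%:E + q%:E <= (q * - ln r)%:E + r%:E.
Proof.
move=> q0 r0; rewrite entropy_term_EFin// -!EFinD lee_fin.
move: q0; rewrite le_eqVlt => /predU1P[<-|q0].
  by rewrite !mul0r !add0r ltW.
have : (ln (1 + (r / q - 1)) <= r / q - 1)%R.
  by apply: le_ln1Dx; rewrite ltrBDr addNr divr_gt0.
rewrite addrC subrK ln_div ?posrE// => h.
have := ler_wpM2l (ltW q0) h.
rewrite [X in (_ <= X)%R]mulrBr mulrCA divff ?gt_eqF// !mulr1.
lra.
Qed.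

End EntropyTerm.

(** * Unordered sums of nonnegative terms *)

Lemma esumZ {R : realType} {I : choiceType} (D : set I) (c : R)
    (f : I -> \bar R) : 0 <= c -> (forall i, 0 <= f i)%E ->
  (\esum_(i in D) (c%:E * f i) = c%:E * \esum_(i in D) f i)%E.
Proof.
move=> c0 f0; have le (a : R) (g : I -> \bar R) : 0 <= a ->
    (forall i, 0 <= g i)%E ->
    (\esum_(i in D) (a%:E * g i) <= a%:E * \esum_(i in D) g i)%E.
  move=> a0 g0; apply: ge_ereal_sup => _ [F [finF FD] <-].
  rewrite -ge0_mule_fsumr//.
  by apply: lee_wpmul2l; rewrite ?lee_fin//; apply: esum_ge; exists F.
apply/eqP; rewrite eq_le le//=.
move: c0; rewrite [0 <= c]le_eqVlt => /predU1P[<-|c0].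
  by rewrite mul0e; apply: esum_ge0 => i _; rewrite mul0e.
rewrite -[leRHS]mul1e -(@mulfV _ c) ?gt_eqF// EFinM -muleA.
apply: lee_wpmul2l; first by rewrite lee_fin ltW.
apply: le_trans (le _ _ _ _); last 2 first.
- by rewrite invr_ge0 ltW.
- by move=> i; rewrite mule_ge0// lee_fin ltW.
apply: le_esum => i _.
by rewrite muleA -EFinM mulVf ?gt_eqF// mul1e.
Qed.

(** Only an upper bound, since [s] may have repetitions and entries outside [D]. *)
Lemma esum_mem_seq {R : realType} (I : choiceType) (D : set I) (s : seq I)
    (c : R) : 0 <= c ->
  (\esum_(i in D) (if i \in s then c else 0)%:E <= ((size s)%:R * c)%:E)%E.
Proof.
move=> c0; elim: s => [|a s IHs].
  by rewrite esum1 ?mul0r// => i _; rewrite in_nil.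
apply: (@le_trans _ _ (\esum_(i in D)
    ((if i == a then c else 0)%:E + (if i \in s then c else 0)%:E))%E).
  apply: le_esum => i _; rewrite in_cons -EFinD lee_fin.
  by case: eqP => _ /=; case: ifP => _; lra.
rewrite esumD; [|by move=> i _; rewrite lee_fin; case: ifP..].
rewrite /= mulrSr addrC mulrDl mul1r EFinD leeD//.
apply: (@le_trans _ _ (\esum_(i in [set a]) c%:E)%E); last by rewrite esum_set1.
apply: (@le_trans _ _ (\esum_(i in D `&` [set a]) c%:E)%E).
  rewrite esum_mkcondr; apply: le_esum => i _.
  have [->|_] := eqVneq i a; first by rewrite mem_set.
  by case: ifP; rewrite ?lee_fin.
by rewrite esum_mkcondl; apply: le_esum => i _; case: ifP => // _; rewrite lee_fin.
Qed.

(** * Entropy of countable partitions *)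

(** A list bounds the count without cardinals: repetitions and entries outside [beta] are harmless,
    and empty intersections are not counted. *)
Definition meets_at_most {X : ptopologicalType} (k : nat) (beta : set (set X))
    (A : set X) : Prop :=
  exists2 s : seq (set X), (size s <= k)%N &
    forall B, beta B -> A `&` B !=set0 -> B \in s.

Section Partitions.
Context {R : realType} {X : ptopologicalType}.
Context (mu : probability (borel X) R).
Implicit Types (alpha beta : set (set X)).
Local Open Scope ereal_scope.

(** Countable additivity, transported along a bijection of [D] with a set of natural numbers. *)
Lemma esum_measure_cover (I : pointedType) (D : set I) (F : I -> set (borel X)) :
  countable D -> (forall i, D i -> measurable (F i)) -> trivIset D F ->
  \esum_(i in D) mu (F i) = mu (\bigcup_(i in D) F i).
Proof.
move=> /countable_bijP[B]; rewrite card_eq_sym.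
move=> /card_set_bijP[f fbij] mF tF.
have [Bf injf fsurj] := fbij.
rewrite (reindex_esum B D f)// (reindex_bigcup f B)//.
rewrite measure_bigcup; first by rewrite nneseries_esum// set_mem_set.
- by move=> i Bi; apply: mF; exact: Bf.
- apply/trivIsetP => i j Bi Bj ij.
  move/trivIsetP : tF; apply; [exact: Bf|exact: Bf|].
  apply: contra ij => /eqP fij; apply/eqP.
  by apply: injf => //; rewrite inE.
Qed.

Lemma esum_measure_partition alpha (B : set X) : borel_partition alpha ->
  measurable (B : set (borel X)) ->
  \esum_(A in alpha) mu (A `&` B) = mu B.
Proof.
move=> [ca ma ta cova] mB.
rewrite (@esum_measure_cover _ alpha (fun A => A `&` B)) //.
- by rewrite -setI_bigcupl [X in X `&` _]cova setTI.
- by move=> A aA; apply: measurableI => //; exact: ma.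
- apply/trivIsetP => A1 A2 a1 a2 ne.
  have /trivIsetP/(_ _ _ a1 a2 ne) := ta.
  by rewrite setIACA => ->; rewrite set0I.
Qed.

Lemma entropyE alpha :
  entropy mu alpha = \esum_(A in alpha) entropy_term (mu A).
Proof. by []. Qed.

Lemma fine_prob (A : set X) : measurable (A : set (borel X)) ->
  exists2 p : R, mu A = p%:E & (0 <= p <= 1)%R.
Proof.
move=> mA; exists (fine (mu A)).
  by rewrite fineK// fin_num_measure.
rewrite fine_ge0//= -lee_fin fineK ?fin_num_measure//.
exact: probability_le1.
Qed.

(** Concavity: the at most [k] nonempty pieces of a cell of mass $p$ are compared with [k] equal
    pieces of mass $p/k$, through the tangent of $-x\ln x$ at $p/k$. *)
Lemma esum_pieces_entropy_le beta (A : set X) (k : nat) :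
  borel_partition beta -> measurable (A : set (borel X)) ->
  (0 < k)%N -> meets_at_most k beta A ->
  \esum_(B in beta) entropy_term (mu (A `&` B)) <=
  entropy_term (mu A) + (ln k%:R)%:E * mu A.
Proof.
move=> pbeta mA k0 [s sk meets].
have [cb mb _ _] := pbeta.
have sumA : \esum_(B in beta) mu (A `&` B) = mu A.
  by rewrite -(esum_measure_partition pbeta mA); apply: eq_esum => B _; rewrite setIC.
have mAB B : beta B -> measurable (A `&` B : set (borel X)).
  by move=> bB; apply: measurableI => //; exact: mb.
have [p muA /andP[p0 p1]] := fine_prob mA.
(* Null cells are treated apart, since the tangent point $p/k$ must be positive. *)
move: (p0); rewrite le_eqVlt => /predU1P[p_eq0|p_gt0].
  rewrite muA -p_eq0 mule0 adde0 esum1 ?entropy_term_EFin ?mul0r// => B bB.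
  suff -> : mu (A `&` B) = 0 by rewrite entropy_term_EFin ?mul0r.
  apply/eqP; rewrite eq_le measure_ge0 andbT.
  have : mu A <= 0 by rewrite muA -p_eq0.
  apply: le_trans; apply: le_measure; rewrite ?inE//; exact: mAB.
have k_gt0 : (0 < k%:R :> R)%R by rewrite ltr0n.
have r_gt0 : (0 < p / k%:R)%R by rewrite divr_gt0.
have r_le1 : (p / k%:R <= 1)%R.
  by rewrite ler_pdivrMr// mul1r (le_trans p1)// ler1n.
have lnr : (0 <= - ln (p / k%:R))%R by rewrite oppr_ge0 ln_le0.
(* On the left the added $p$ is the total mass of the pieces; on the right it bounds the sum of the
   tangent constants $p/k$, of which at most [k] occur. *)
have h : \esum_(B in beta) entropy_term (mu (A `&` B)) + p%:E <=
    ((- ln (p / k%:R)) * p)%:E + p%:E.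
  rewrite -[X in _ + X <= _]muA -[X in _ + X <= _]sumA -esumD; last 2 first.
  - by move=> B bB; have [q -> q01] := fine_prob (mAB _ bB);
      exact: entropy_term_ge0.
  - by move=> B _; exact: measure_ge0.
  apply: (@le_trans _ _ (\esum_(B in beta)
      ((- ln (p / k%:R))%:E * mu (A `&` B) +
      (if B \in s then p / k%:R else 0)%:E))).
    apply: le_esum => B bB; case: ifPn => [_|Bs].
      have [q -> /andP[q0 q1]] := fine_prob (mAB _ bB).
      by rewrite -EFinM mulrC; exact: entropy_term_tangent.
    have -> : A `&` B = set0.
      apply/eqP; apply: contraNT Bs => /set0P; exact: meets.
    by rewrite measure0 !mule0 !adde0 entropy_term_EFin ?mul0r.
  rewrite esumD; last 2 first.
  - by move=> B _; rewrite mule_ge0// lee_fin.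
  - by move=> B _; rewrite lee_fin; case: ifP => // _; exact: ltW.
  rewrite esumZ// sumA muA -EFinM leeD//.
  apply: le_trans (esum_mem_seq _ _ (ltW r_gt0)) _.
  by rewrite lee_fin mulrA ler_pdivrMr// mulrC ler_pM2l// ler_nat.
rewrite leeD2rE// in h.
apply: le_trans h _; rewrite muA entropy_term_EFin// -EFinM -EFinD lee_fin.
by rewrite ln_div ?posrE//; lra.
Qed.

(* Subadditivity of [- x ln x] bounds [H(beta)] by the entropy of the common
   refinement, whose excess over [H(alpha)] is at most [ln k] cell by cell. *)
Lemma entropy_le_meets alpha beta (k : nat) :
  borel_partition alpha -> borel_partition beta -> (0 < k)%N ->
  (forall A, alpha A -> meets_at_most k beta A) ->
  entropy mu beta <= entropy mu alpha + (ln k%:R)%:E.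
Proof.
move=> palpha pbeta k0 meets.
have [ca ma _ cova] := palpha; have [cb mb _ _] := pbeta.
have mAB A B : alpha A -> beta B -> measurable (A `&` B : set (borel X)).
  by move=> aA bB; apply: measurableI; [exact: ma|exact: mb].
have term_ge0 A B : alpha A -> beta B -> 0 <= entropy_term (mu (A `&` B)).
  move=> aA bB; have [q -> q01] := fine_prob (mAB _ _ aA bB).
  exact: entropy_term_ge0.
rewrite !entropyE.
apply: (@le_trans _ _ (\esum_(B in beta) \esum_(A in alpha)
    entropy_term (mu (A `&` B)))).
  apply: le_esum => B bB.
  have mB : measurable (B : set (borel X)) := mb _ bB.
  have [p muB /andP[p0 p1]] := fine_prob mB.
  have lnp : (0 <= - ln p)%R by rewrite oppr_ge0 ln_le0.
  rewrite muB entropy_term_EFin// mulrC EFinM -muB.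
  rewrite -(esum_measure_partition palpha mB) -esumZ//.
  apply: le_esum => A aA.
  have [q muq /andP[q0 q1]] := fine_prob (mAB _ _ aA bB).
  rewrite muq -EFinM mulrC entropy_term_lower//.
  rewrite -lee_fin -muq -muB le_measure ?inE//; exact: mAB.
rewrite esum_esum; last by move=> B A bB aA; exact: term_ge0.
rewrite (reindex_esum (alpha `*`` (fun=> beta)) _ (fun x => (x.2, x.1))); last first.
  split => //=.
  - by move=> [i j] [].
  - by move=> [i1 i2] [j1 j2] /= _ _ [] -> ->.
  - by move=> [i1 i2] [Pi1 Qi2] /=; exists (i2, i1).
rewrite -(@esum_esum _ _ _ _ _ (fun A B => entropy_term (mu (A `&` B)))) //.
apply: (@le_trans _ _ (\esum_(A in alpha)
    (entropy_term (mu A) + (ln k%:R)%:E * mu A))).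
  apply: le_esum => A aA.
  exact: (esum_pieces_entropy_le pbeta (ma _ aA) k0 (meets _ aA)).
have lnk : (0 <= ln k%:R :> R)%R by rewrite ln_ge0// ler1n.
rewrite esumD; last 2 first.
- by move=> A aA; have [q -> q01] := fine_prob (ma _ aA);
    exact: entropy_term_ge0.
- by move=> A _; rewrite mule_ge0// lee_fin.
rewrite esumZ// leeD2l//.
have := esum_measure_partition palpha
  (measurableT : measurable ([set: X] : set (borel X))).
under eq_esum do rewrite setIT.
by move=> ->; rewrite probability_setT mule1.
Qed.

End Partitions.

(** * Iterated joins, refinement and counting of cells *)

Section Refinement.
Context {X : ptopologicalType}.
Implicit Types (alpha beta : set (set X)) (T : X -> X).

(* Iterated joins may contain extra empty cells, so partitions are compared
   through the relation of lying in a common cell rather than as sets of sets. *)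
Definition same_cell alpha (x y : X) : Prop :=
  exists2 A, alpha A & A x /\ A y.

Definition borel_map T : Prop := forall A : set (borel X),
  measurable A -> measurable (T @^-1` A : set (borel X)).

Lemma borel_map_iter T j : borel_map T -> borel_map (iter j T).
Proof.
move=> mT; elim: j => [//|j IHj] A mA.
rewrite (_ : _ @^-1` _ = iter j T @^-1` (T @^-1` A))//.
by apply: (IHj (T @^-1` A)); exact: mT.
Qed.

Lemma borel_partition_setT : borel_partition [set [set: X]].
Proof.
split => //.
- by move=> A ->; exact: measurableT.
- by move=> A B -> ->.
- by rewrite /cover bigcup_set1.
Qed.

Lemma trivIset_idP alpha : trivIset alpha id <->
  forall A B x, alpha A -> alpha B -> A x -> B x -> A = B.
Proof.
split=> [t A B x aA aB Ax Bx|h A B aA aB [x [Ax Bx]]]; last exact: h Ax Bx.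
by apply: t => //; exists x.
Qed.

Lemma borel_partition_pjoin alpha beta : borel_partition alpha ->
  borel_partition beta -> borel_partition (pjoin alpha beta).
Proof.
move=> [ca ma /trivIset_idP ta cova] [cb mb /trivIset_idP tb covb]; split.
- rewrite /pjoin image2E.
  by apply: card_le_trans (card_image_le _ _) _; exact: countableX.
- by move=> _ [A aA [B bB <-]]; apply: measurableI; [exact: ma|exact: mb].
- apply/trivIset_idP => _ _ x [A aA [B bB <-]] [A' aA' [B' bB' <-]].
  move=> [Ax Bx] [A'x B'x].
  by rewrite (ta A A' x)// (tb B B' x).
- apply/seteqP; split=> // x _.
  have : cover alpha id x by rewrite cova.
  have : cover beta id x by rewrite covb.
  move=> [B bB Bx] [A aA Ax]; exists (A `&` B) => //.
  by exists A => //; exists B.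
Qed.

Lemma borel_partition_preim T j alpha : borel_map T ->
  borel_partition alpha -> borel_partition (preim_part T j alpha).
Proof.
move=> mT [ca ma /trivIset_idP ta cova]; split.
- by apply: card_le_trans (card_image_le _ _) _.
- by move=> _ [A aA <-]; apply: (borel_map_iter j mT); exact: ma.
- apply/trivIset_idP => _ _ x [A aA <-] [A' aA' <-] Ax A'x.
  by rewrite (ta A A' (iter j T x)).
- apply/seteqP; split=> // x _.
  have : cover alpha id (iter j T x) by rewrite cova.
  by move=> [A aA Ax]; exists (iter j T @^-1` A) => //; exists A.
Qed.

Lemma borel_partition_part_iter T alpha n : borel_map T ->
  borel_partition alpha -> borel_partition (part_iter T alpha n).
Proof.
move=> mT pa; apply: big_ind => [|a b|j _].
- exact: borel_partition_setT.
- exact: borel_partition_pjoin.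
- exact: borel_partition_preim.
Qed.

Lemma same_cell_pjoin alpha beta x y :
  same_cell (pjoin alpha beta) x y <-> same_cell alpha x y /\ same_cell beta x y.
Proof.
split=> [[_ [A aA [B bB <-]] [[Ax Bx] [Ay By]]]|]; first by split; [exists A|exists B].
move=> [[A aA [Ax Ay]] [B bB [Bx By]]]; exists (A `&` B) => //.
by exists A => //; exists B.
Qed.

Lemma same_cell_preim T j alpha x y :
  same_cell (preim_part T j alpha) x y <->
  same_cell alpha (iter j T x) (iter j T y).
Proof.
split=> [[_ [A aA <-] [Ax Ay]]|[A aA [Ax Ay]]]; first by exists A.
by exists (iter j T @^-1` A) => //; exists A.
Qed.

Lemma same_cell_big (I : eqType) (s : seq I) (F : I -> set (set X)) x y :
  same_cell (\big[@pjoin X/[set setT]]_(j <- s) F j) x y <->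
  forall j, j \in s -> same_cell (F j) x y.
Proof.
elim: s => [|i s IHs]; first by rewrite big_nil; split=> // _; exists setT.
rewrite big_cons; split=> [/same_cell_pjoin[hi /IHs hs] j|h].
  by rewrite in_cons => /predU1P[->//|]; exact: hs.
apply/same_cell_pjoin; split; first by apply: h; rewrite mem_head.
by apply/IHs => j js; apply: h; rewrite in_cons js orbT.
Qed.

Lemma same_cell_part_iter T alpha n x y :
  same_cell (part_iter T alpha n) x y <->
  forall j, (j < n)%N -> same_cell alpha (iter j T x) (iter j T y).
Proof.
split=> [/same_cell_big h j jn|h].
  by apply/same_cell_preim; exact: (h (Ordinal jn) (mem_index_enum _)).
by apply/same_cell_big => j _; apply/same_cell_preim; exact: h.
Qed.

(** The counts multiply: $A_1\cap A_2$ meets $B_1\cap B_2$ only if each $A_i$ meets $B_i$. *)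
Lemma meets_at_most_big (I : Type) (s : seq I) (F G : I -> set (set X)) k :
  (forall i A, F i A -> meets_at_most k (G i) A) ->
  forall A, (\big[@pjoin X/[set setT]]_(j <- s) F j) A ->
    meets_at_most (k ^ size s) (\big[@pjoin X/[set setT]]_(j <- s) G j) A.
Proof.
move=> h; elim: s => [|j s IHs] A.
  by rewrite !big_nil => _; exists [:: setT] => // B -> _; rewrite mem_head.
rewrite !big_cons => -[A1 /h[s1 s1k s1P] [A2 /IHs[s2 s2k s2P] <-]].
exists [seq B1 `&` B2 | B1 <- s1, B2 <- s2].
  by rewrite size_allpairs expnS leq_mul.
move=> _ [B1 bB1 [B2 bB2 <-]] [x [[A1x A2x] [B1x B2x]]].
apply/allpairsP; exists (B1, B2); split=> //=.
- by apply: s1P => //; exists x.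
- by apply: s2P => //; exists x.
Qed.

Lemma meets_at_most_part_iter T alpha beta k n :
  (forall A, alpha A -> meets_at_most k beta A) ->
  forall A, part_iter T alpha n A -> meets_at_most (k ^ n) (part_iter T beta n) A.
Proof.
move=> h A An; rewrite -[n in (_ ^ n)%N]size_enum_ord enumT.
apply: meets_at_most_big An => j _ [A' /h[s sk sP] <-].
exists [seq iter j T @^-1` B | B <- s]; first by rewrite size_map.
move=> _ [B bB <-] [x [A'x Bx]]; apply: map_f; apply: sP => //.
by exists (iter j T x).
Qed.

(** Makes monotonicity of entropy under refinement the case $k=1$ of the counting estimate, with
    excess $\ln 1=0$. *)
Lemma meets_at_most_refine alpha beta : borel_partition beta ->
  (forall x y, same_cell alpha x y -> same_cell beta x y) ->
  forall A, alpha A -> meets_at_most 1 beta A.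
Proof.
move=> [_ _ /trivIset_idP tb covb] ref A aA.
have [->|/set0P[x Ax]] := eqVneq A set0.
  by exists [::] => // B _ [x []].
have : cover beta id x by rewrite covb.
move=> [B bB Bx]; exists [:: B] => // B' bB' [y [Ay B'y]].
have [C bC [Cx Cy]] := ref x y (ex_intro2 _ _ A aA (conj Ax Ay)).
by rewrite (tb B' C y)// (tb B C x)// mem_head.
Qed.

End Refinement.

(** * Comparison of entropy rates *)

Section EntropyRate.
Context {R : realType} {X : ptopologicalType}.
Context (mu : probability (borel X) R).
Implicit Types (alpha beta : set (set X)) (T : X -> X).
Local Open Scope ereal_scope.

Lemma entropy_le_refine alpha beta :
  borel_partition alpha -> borel_partition beta ->
  (forall x y, same_cell alpha x y -> same_cell beta x y) ->
  entropy mu beta <= entropy mu alpha.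
Proof.
move=> pa pb ref.
have := entropy_le_meets mu pa pb (ltnSn 0) (meets_at_most_refine pb ref).
by rewrite ln1 adde0.
Qed.

Lemma invariant_measure_iter T j : borel_map T -> invariant_measure T mu ->
  invariant_measure (iter j T) mu.
Proof.
move=> mT iT; elim: j => [//|j IHj] A mA.
rewrite (_ : _ @^-1` _ = iter j T @^-1` (T @^-1` A))// IHj ?iT//.
exact: mT.
Qed.

(** Surjectivity of [T] keeps the preimages of distinct cells distinct, so the sum can be reindexed
    by [alpha]. *)
Lemma entropy_preim T j alpha : borel_map T -> invariant_measure T mu ->
  set_surj setT setT T -> borel_partition alpha ->
  entropy mu (preim_part T j alpha) = entropy mu alpha.
Proof.
move=> mT iT sT [ca ma _ _]; rewrite /entropy /preim_part esum_image.
  apply: eq_esum => A aA.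
  by rewrite invariant_measure_iter//; exact: ma.
have {}sT : forall y, exists x, iter j T x = y.
  elim: j => [|j IHj] y; first by exists y.
  by have [x _ <-] := sT y I; have [z <-] := IHj x; exists z.
move=> A B _ _ AB; apply/seteqP; split=> y; have [x <-] := sT y.
  by rewrite -[A _]/((iter j T @^-1` A) x) AB.
by rewrite -[B _]/((iter j T @^-1` B) x) -AB.
Qed.

Lemma entropy_ge0 alpha : borel_partition alpha -> 0 <= entropy mu alpha.
Proof.
move=> [_ ma _ _]; apply: esum_ge0 => A aA.
by have [p -> p01] := fine_prob mu (ma _ aA); exact: entropy_term_ge0.
Qed.

Lemma entropy_rate_ge0 T alpha : borel_map T -> borel_partition alpha ->
  0 <= entropy_rate T mu alpha.
Proof.
move=> mT pa; rewrite /entropy_rate; case: asboolP => // _.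
apply: limf_esup_ge0; first exact: filter_not_empty.
move=> n; rewrite mule_ge0 ?lee_fin ?invr_ge0//.
exact/entropy_ge0/borel_partition_part_iter.
Qed.

(** A bounded time shift does not change the rate, because $(n+K)/n\to1$. *)
Lemma le_entropy_rate_shift T alpha beta (K : nat) :
  borel_map T -> borel_partition alpha ->
  (forall n, entropy mu (part_iter T beta n) <=
    entropy mu (part_iter T alpha (n + K))) ->
  entropy_rate T mu beta <= entropy_rate T mu alpha.
Proof.
move=> mT pa le; rewrite /entropy_rate.
case: (asboolP (exists n, entropy mu (part_iter T alpha n) = +oo)) => [_|fina].
  by rewrite leey.
case: asboolP => [[n bn]|_].
  exfalso; apply: fina; exists (n + K)%N; apply/eqP.
  by rewrite -leye_eq -bn.
rewrite /limn_esup; apply: (le_limf_esup (phi := (addn^~ K))).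
  exact: cvg_addnr.
move=> d d0; near=> n.
(* $K+1$ in place of $K$, because the constant has to be positive even for $K=0$. *)
apply: (@scaled_le _ _ _ (K.+1)%:R) => //.
- near: n; exact: nbhs_infty_ger.
- by rewrite ltr0n addn_gt0; apply/orP; left; near: n; exact: nbhs_infty_gt.
- by rewrite -natrD ler_nat leq_add2l.
- exact/entropy_ge0/borel_partition_part_iter.
- by rewrite (le_trans (le n))// leeDl// lee_fin.
Unshelve. all: by end_near. Qed.

(** The count $k^n$ for the $n$-th iterates adds $n\ln k$ to the entropy, hence $\ln k$ after
    division by $n$. *)
Lemma entropy_rate_le_meets T alpha beta (k : nat) :
  borel_map T -> borel_partition alpha -> borel_partition beta -> (0 < k)%N ->
  (forall A, alpha A -> meets_at_most k beta A) ->
  entropy_rate T mu beta <= entropy_rate T mu alpha + (ln k%:R)%:E.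
Proof.
move=> mT pa pb k0 meets.
have le n : entropy mu (part_iter T beta n) <=
    entropy mu (part_iter T alpha n) + (n%:R * ln k%:R)%:E.
  rewrite mulr_natl -lnXn ?ltr0n// -natrX.
  apply: entropy_le_meets.
  - exact: borel_partition_part_iter.
  - exact: borel_partition_part_iter.
  - by rewrite expn_gt0 k0.
  - exact: meets_at_most_part_iter.
rewrite /entropy_rate.
case: (asboolP (exists n, entropy mu (part_iter T alpha n) = +oo)) => [_|fina].
  by rewrite leey.
case: asboolP => [[n bn]|_].
  exfalso; apply: fina; exists n; apply/eqP.
  by have := le n; rewrite bn leye_eq; case: (entropy mu (part_iter T alpha n)).
apply: limn_esup_le_addr => n.
apply: (@le_trans _ _ ((n%:R^-1)%:E *
    (entropy mu (part_iter T alpha n) + (n%:R * ln k%:R)%:E))).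
  by rewrite lee_wpmul2l// lee_fin invr_ge0.
have lnk : (0 <= ln k%:R :> R)%R by rewrite ln_ge0// ler1n.
rewrite ge0_muleDr//; last 2 first.
- exact/entropy_ge0/borel_partition_part_iter.
- by rewrite lee_fin mulr_ge0.
rewrite leeD2l// -EFinM lee_fin mulrA.
(* For $n=0$ the product $n^{-1}n$ is $0$ by convention, and $\ln k\ge0$ suffices. *)
case: n => [|n]; first by rewrite mulr0 mul0r.
by rewrite mulVf ?mul1r// pnatr_eq0.
Qed.

End EntropyRate.

(** * Continuity and measurability of the shifts *)

Lemma continuous_borel_map (X : ptopologicalType) (f : X -> X) :
  continuous f -> borel_map f.
Proof.
move=> /continuousP cf A mA.
have mf : measurable_fun [set: borel X] (f : borel X -> borel X).
  apply: (@measurability _ _ (borel X) (borel X) setT f (@open X)) => //.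
  move=> _ [B oB <-]; rewrite setTI; apply: sub_sigma_algebra; exact: cf.
by rewrite -[X in measurable X]setTI; exact: mf.
Qed.

(** The product topology is the supremum of the initial topologies of the projections, so only
    preimages of open sets under single coordinates need testing. *)
Lemma continuous_into_prod (I : Type) (K : I -> topologicalType)
    (X : topologicalType) (f : X -> prod_topology K) :
  (forall i, continuous (fun x => f x i)) -> continuous f.
Proof.
move=> cf x; apply/cvg_sup => i A [_ [[B oB <-] Bx] BA].
have Bi : nbhs x ((fun y => f y i) @^-1` B).
  by apply: cf; apply: open_nbhs_nbhs; split.
by apply: filterS Bi => y By; exact: BA.
Qed.

Section Shift.
Context {R : realType}.
Implicit Types (x y : unit_seq R).

(** Both directions of the shift lie in one family, which turns compositions into integer
    addition. *)
Definition zshift (k : int) x : unit_seq R := fun n => x (n + k).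

Lemma coord_continuous n : continuous (fun x => unit_coord x n).
Proof.
move=> x; apply: (@continuous_comp _ _ _ (fun x : unit_seq R => x n) val).
  exact: (@proj_continuous int (fun=> unit_itv R) n).
exact: (@initial_continuous (set_type [set` `[0 : R, 1]]) _ set_val).
Qed.

Lemma zshift_continuous k : continuous (zshift k).
Proof.
apply: (@continuous_into_prod int (fun=> unit_itv R) (unit_seq R)) => i.
exact: (@proj_continuous int (fun=> unit_itv R) (i + k)).
Qed.

Lemma zshift_borel_map k : borel_map (zshift k).
Proof. by apply: continuous_borel_map; exact: zshift_continuous. Qed.

Lemma iter_zshift j k x : iter j (zshift k) x = zshift (k *+ j) x.
Proof.
elim: j => [|j IHj] /=; apply/funext => n.
  by rewrite /zshift mulr0n addr0.
by rewrite IHj /zshift mulrS addrA.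
Qed.

Lemma left_shiftE : left_shift = zshift 1.
Proof. by []. Qed.

Lemma zshiftK k : cancel (zshift k) (zshift (- k)).
Proof. by move=> x; apply/funext => n; rewrite /zshift addrNK. Qed.

Lemma unit_coord_itv x n : 0 <= unit_coord x n <= 1.
Proof.
by rewrite /unit_coord; case: (x n) => t /=; rewrite inE /= in_itv.
Qed.

End Shift.

(** * The metric and single coordinates *)

Section Distance.
Context {R : realType}.
Implicit Types (x y : unit_seq R).

(** The nonnegative and the negative integers each contribute at most the full geometric series;
    [Negz n] has absolute value $n+1\ge n$. *)
Lemma esum_int_geometric (r : R) : 0 < r < 1 ->
  (\esum_(n in [set: int]) (r ^+ absz n)%:E <= (2 / (1 - r))%:E)%E.
Proof.
move=> /andP[r0 r1].
have geo : (\esum_(n in [set: nat]) (r ^+ n)%:E <= (1 / (1 - r))%:E)%E.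
  rewrite -nneseries_esumT; last by move=> n; rewrite lee_fin exprn_ge0// ltW.
  apply: lime_le.
    by apply: is_cvg_nneseries => n _ _; rewrite lee_fin exprn_ge0// ltW.
  apply: nearW => n; rewrite sumEFin lee_fin.
  have /(_ n) := @geometric_le_lim R _ 1 r ler01 r0.
  rewrite (ger0_norm (ltW r0)) => /(_ r1); rewrite seriesEnat /= div1r.
  by apply: le_trans; apply: ler_sum => i _; rewrite /= mul1r.
have half (e : nat -> int) : injective e -> (forall n, (n <= absz (e n))%N) ->
    (\esum_(i in range e) (r ^+ absz i)%:E <= (1 / (1 - r))%:E)%E.
  move=> inj le; rewrite esum_image; last by move=> ? ? _ _; exact: inj.
  apply: le_trans geo; apply: le_esum => n _.
  by rewrite lee_fin ler_wiXn2l// ltW.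
rewrite (esumID (range Posz)); last first.
  by move=> n _; rewrite lee_fin exprn_ge0// ltW.
rewrite !setTI (_ : (2 / (1 - r))%:E = (1 / (1 - r))%:E + (1 / (1 - r))%:E)%E; last first.
  by rewrite -EFinD -mulrDl.
apply: leeD; first by apply: half => // ? ? [].
suff -> : ~` range Posz = range Negz by apply: half => // ? ? [].
apply/seteqP; split=> [[n|n] //= | _ [n _ <-] [m _]//].
- by move=> h; exfalso; apply: h; exists n.
- by move=> _; exists n.
Qed.

(** The term at $0$ has weight $1$ and all others are nonnegative. *)
Lemma coord_le_distZ x y : `|unit_coord x 0 - unit_coord y 0| <= distZ x y.
Proof.
have pos n : (0 <= (`|unit_coord x n - unit_coord y n| / 2 ^+ absz n)%:E)%E.
  by rewrite lee_fin divr_ge0// exprn_ge0.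
rewrite -lee_fin /distZ fineK; last first.
  by rewrite ge0_fin_numE ?distZ_series_lty//; apply: esum_ge0 => n _.
apply: esum_ge; exists [set 0 : int]; first by split => //; exact: finite_set1.
by rewrite fsbig_set1 expr0 divr1.
Qed.

(* Beyond [L] the factor [2^-|n|] splits as [(2/3)^|n| (3/4)^|n|], so that both
   the head and the tail of the series are dominated by [e (3/4)^|n|]. *)
Lemma distZ_le x y (e : R) (L : nat) : 0 <= e -> (2 / 3) ^+ L <= e ->
  (forall n : int, (absz n <= L)%N -> `|unit_coord x n - unit_coord y n| <= e) ->
  distZ x y <= 8 * e.
Proof.
move=> e0 Le xye.
rewrite -lee_fin /distZ fineK; last first.
  rewrite ge0_fin_numE ?distZ_series_lty//; apply: esum_ge0 => n _.
  by rewrite lee_fin divr_ge0// exprn_ge0.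
apply: (@le_trans _ _ (\esum_(n in [set: int]) (e%:E * ((3 / 4) ^+ absz n)%:E))%E).
  apply: le_esum => n _; rewrite -EFinM lee_fin.
  have [nL|Ln] := leqP (absz n) L.
    rewrite ler_pM ?invr_ge0 ?exprn_ge0 ?xye//.
    by rewrite -exprVn lerXn2r// ?nnegrE//; lra.
  apply: (@le_trans _ _ (1 / 2 ^+ absz n)).
    rewrite ler_wpM2r ?invr_ge0 ?exprn_ge0// ler_distl.
    by have := unit_coord_itv x n; have := unit_coord_itv y n; lra.
  have -> : 1 / 2 ^+ absz n = (2 / 3 : R) ^+ absz n * (3 / 4) ^+ absz n.
    rewrite -exprMn div1r -exprVn; congr (_ ^+ _); lra.
  rewrite ler_wpM2r ?exprn_ge0// (le_trans _ Le)// ler_wiXn2l//; first lra.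
  exact: ltnW.
rewrite esumZ//.
(* The constant $8$ is the two-sided geometric bound $2/(1-r)$ at $r=3/4$. *)
have -> : (8 * e)%:E = (e%:E * (2 / (1 - 3 / 4))%:E)%E.
  by rewrite -EFinM; congr (_%:E); field.
rewrite lee_wpmul2l ?lee_fin// esum_int_geometric//; lra.
Qed.

End Distance.

(** * The partitions $\alpha_m$ *)

Section Cylinder.
Context {R : realType}.
Implicit Types (x y : unit_seq R) (m : nat).

Definition cylinder m (i : int) : set (unit_seq R) :=
  unit_coord^~ 0 @^-1` `[i%:~R / m%:R, (i + 1)%:~R / m%:R[.

(** The index of the cell becomes a function of the point, which yields disjointness and covering at
    once. *)
Lemma cylinderP m i x : (0 < m)%N ->
  cylinder m i x <-> Num.floor (unit_coord x 0 * m%:R) = i.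
Proof.
move=> m0; have m0R : 0 < m%:R :> R by rewrite ltr0n.
rewrite /cylinder /= in_itv /= ler_pdivrMr// ltr_pdivlMr//.
split=> [|<-]; first exact: floor_def.
exact: floor_itv.
Qed.

Lemma cylinder_measurable m i :
  measurable (cylinder m i : set (borel (unit_seq R))).
Proof.
pose f x : R := unit_coord x 0.
have /continuousP cf : continuous f := @coord_continuous R 0.
have op (A : set R) : open A -> measurable (f @^-1` A : set (borel (unit_seq R))).
  by move=> oA; apply: sub_sigma_algebra; exact: cf.
have -> : cylinder m i = ~` (f @^-1` [set t | t < i%:~R / m%:R]) `&`
    f @^-1` [set t | t < (i + 1)%:~R / m%:R].
  apply/seteqP; split=> x; rewrite /cylinder /= in_itv /=.
    by move=> /andP[h1 h2]; split=> //; apply/negP; rewrite -leNgt.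
  by move=> [/negP]; rewrite -leNgt => -> ->.
by apply: measurableI; [apply: measurableC|]; apply: op; exact: open_lt.
Qed.

Lemma cylinder_partition m : (0 < m)%N ->
  borel_partition (@cylinder_part R m).
Proof.
move=> m0; split.
- by apply: card_le_trans (card_image_le _ _) _; exact: countableP.
- by move=> _ [i _ <-]; exact: cylinder_measurable.
- apply/trivIset_idP => _ _ x [i _ <-] [j _ <-].
  by move=> /(cylinderP _ _ m0) <- /(cylinderP _ _ m0) <-.
- apply/seteqP; split=> // x _.
  exists (cylinder m (Num.floor (unit_coord x 0 * m%:R))); last exact/cylinderP.
  by exists (Num.floor (unit_coord x 0 * m%:R)).
Qed.

Lemma same_cell_cylinder m x y : (0 < m)%N ->
  same_cell (@cylinder_part R m) x y ->
  `|unit_coord x 0 - unit_coord y 0| <= m%:R^-1.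
Proof.
move=> m0 [_ [i _ <-]]; have m0R : 0 < m%:R :> R by rewrite ltr0n.
rewrite /= !in_itv /= => -[/andP[x1 x2] /andP[y1 y2]].
rewrite intrD mulrDl mul1r in x2 y2.
by rewrite ler_distl; lra.
Qed.

(** On [A] the value $m x_0$ varies by at most $1$, so its floor differs from that of a fixed point
    by at most $1$. *)
Lemma small_meets_cylinders m (A : set (unit_seq R)) (e : R) : (0 < m)%N ->
  m%:R * e <= 1 ->
  (forall x y, A x -> A y -> `|unit_coord x 0 - unit_coord y 0| <= e) ->
  meets_at_most 3 (@cylinder_part R m) A.
Proof.
move=> m0 me dA; have m0R : 0 < m%:R :> R by rewrite ltr0n.
have [->|/set0P[x Ax]] := eqVneq A set0.
  by exists [::] => // B _ [x []].
pose i := Num.floor (unit_coord x 0 * m%:R).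
exists [:: cylinder m (i - 1); cylinder m i; cylinder m (i + 1)] => //.
move=> _ [j _ <-] [y [Ay /(cylinderP _ _ m0) jE]].
suff : j \in [:: i - 1; i; i + 1].
  by rewrite !in_cons !in_nil !orbF => /or3P[] /eqP ->; rewrite eqxx ?orbT.
have xy : `|unit_coord x 0 * m%:R - unit_coord y 0 * m%:R| <= 1.
  rewrite -mulrBl normrM (ger0_norm (ltW m0R)) mulrC; apply: le_trans me.
  by rewrite ler_pM2l// dA.
have /andP[i1 i2] := floor_itv (unit_coord x 0 * m%:R).
have /andP[j1 j2] := floor_itv (unit_coord y 0 * m%:R).
rewrite -/i in i1 i2; rewrite jE in j1 j2.
move: xy; rewrite ler_distl => /andP[h1 h2].
have : (j%:~R < (i + 1 + 1)%:~R :> R) by rewrite intrD; lra.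
have : (i%:~R < (j + 1 + 1)%:~R :> R) by rewrite intrD; lra.
rewrite !ltr_int !in_cons; lia.
Qed.

End Cylinder.

(** * The two inequalities at a fixed scale *)

Section CylinderRate.
Context {R : realType}.
Context (mu : probability (borel (unit_seq R)) R).
Context (mu_inv : invariant_measure left_shift mu).
Let right_shift : unit_seq R -> unit_seq R := zshift (-1).
Local Open Scope ereal_scope.

Lemma left_shift_borel_map : borel_map (@left_shift R).
Proof. exact: (@zshift_borel_map R 1). Qed.

(** Left invariance is applied to the preimage of [A] under the right shift, where the two shifts
    cancel. *)
Lemma right_shift_invariant : invariant_measure right_shift mu.
Proof.
move=> A mA; rewrite -mu_inv; last exact: zshift_borel_map.
congr (mu _); apply/seteqP.
by split=> x /=; rewrite left_shiftE /right_shift (zshiftK 1).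
Qed.

Lemma right_shift_surj : set_surj setT setT right_shift.
Proof.
by move=> x _; exists (zshift 1 x) => //; rewrite /right_shift (zshiftK 1).
Qed.

Lemma iter_shifts (i j L : nat) x :
  iter i (@left_shift R) (iter L right_shift (iter j left_shift x)) =
  iter (j + i) left_shift (iter L right_shift x).
Proof.
rewrite left_shiftE !iter_zshift; apply/funext => n; rewrite /zshift.
by congr (x _); rewrite mulrnDr; ring.
Qed.

Lemma inf_entropy_rate_le_cylinder (m : nat) (eps : R) : (0 < m)%N ->
  (8 <= m%:R * eps)%R ->
  inf_entropy_rate left_shift distZ mu eps <=
  entropy_rate left_shift mu (cylinder_part m).
Proof.
move=> m0 meps; have m0R : (0 < m%:R :> R)%R by rewrite ltr0n.
have pcyl := @cylinder_partition R m m0.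
have mright : borel_map right_shift by exact: zshift_borel_map.
have mleft := left_shift_borel_map.
(* Beyond [L] the tail of the metric is controlled by the cell width $1/m$. *)
have [L Lm] : exists L : nat, ((2 / 3 : R) ^+ L <= m%:R^-1)%R.
  have : (`|2 / 3 : R| < 1)%R by rewrite ger0_norm//; lra.
  move/cvg_expr => /cvgrPdist_le /(_ (m%:R^-1)%R).
  rewrite invr_gt0 => /(_ m0R)[N _ /(_ N (leqnn N))].
  by rewrite sub0r normrN ger0_norm ?exprn_ge0//; exists N.
(* Iterated joins only look forward, at coordinates $0,\dots,2L$; pulling back by [L] right shifts
   centres this window at $-L,\dots,L$. *)
pose K := (L + L).+1.
pose beta := preim_part right_shift L (part_iter left_shift (cylinder_part m) K).
have piter n : borel_partition (part_iter left_shift (@cylinder_part R m) n).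
  exact: borel_partition_part_iter.
have pbeta : borel_partition beta by exact: borel_partition_preim.
apply: (@le_trans _ _ (entropy_rate left_shift mu beta)).
  apply: ereal_inf_lbound; exists beta => //; split => //.
  apply: ge_ereal_sup => _ [A bA <-]; apply: ge_ereal_sup => _ [x Ax [y Ay <-]].
  rewrite lee_fin; apply: (@le_trans _ _ (8 * m%:R^-1)%R); last first.
    by rewrite ler_pdivrMr// mulrC.
  apply: (@distZ_le _ _ _ _ L); rewrite ?invr_ge0// => n nL.
  have /same_cell_preim/same_cell_part_iter : same_cell beta x y by exists A.
  have iK : (absz (n + Posz L)%R < K)%N by rewrite /K; lia.
  move/(_ _ iK)/(same_cell_cylinder m0).
  rewrite left_shiftE /right_shift !iter_zshift /unit_coord /zshift.
  suff -> : (0 + 1 *+ absz (n + Posz L)%R + -1 *+ L)%R = n by [].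
  lia.
apply: (@le_entropy_rate_shift _ _ mu _ _ _ K) => // n.
(* The right shift preserves entropy, so the iterate of length $n+K$ may be moved by [L] onto the
   coordinates seen by the $n$-th iterate of [beta]. *)
rewrite -[leRHS](entropy_preim L mright right_shift_invariant right_shift_surj)//.
apply: entropy_le_refine.
- exact: borel_partition_preim.
- exact: borel_partition_part_iter.
move=> x y /same_cell_preim/same_cell_part_iter h.
apply/same_cell_part_iter => j jn.
apply/same_cell_preim/same_cell_part_iter => i iK.
by rewrite !iter_shifts; apply: h; rewrite -addnS leq_add// ltnW.
Qed.

(** Each competing partition has cells of diameter at most [eps], hence of oscillation at most [eps]
    in coordinate $0$, and so meeting at most three cylinders. *)
Lemma cylinder_le_inf_entropy_rate (m : nat) (eps : R) : (0 < m)%N ->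
  (m%:R * eps <= 1)%R ->
  entropy_rate left_shift mu (cylinder_part m) <=
  inf_entropy_rate left_shift distZ mu eps + (ln 3)%:E.
Proof.
move=> m0 meps; rewrite -leeBlDr//; apply: le_ereal_inf_tmp.
move=> _ [alpha [palpha dalpha] <-]; rewrite leeBlDr//.
apply: entropy_rate_le_meets => //.
- exact: left_shift_borel_map.
- exact: cylinder_partition.
move=> A aA; apply: (small_meets_cylinders m0 meps) => x y Ax Ay.
apply: le_trans (coord_le_distZ x y) _; rewrite -lee_fin.
apply: le_trans dalpha; apply: (@le_trans _ _ (diam distZ A)).
  by apply: ereal_sup_ubound; exists x => //; exists y.
by apply: ereal_sup_ubound; exists A.
Qed.

Lemma inf_entropy_rate_ge0 (eps : R) :
  0 <= inf_entropy_rate left_shift distZ mu eps.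
Proof.
apply: le_ereal_inf_tmp => _ [alpha [pa _] <-].
by apply: entropy_rate_ge0 => //; exact: left_shift_borel_map.
Qed.

End CylinderRate.

(** * Limits relating $m\to\infty$ and $\epsilon\to0^+$ *)

Section LogLimits.
Context {R : realType}.

Lemma near_ln_inv_ge (M : R) : \forall e \near (0 : R)^'+, M <= ln e^-1.
Proof.
near=> e.
have e0 : 0 < e by near: e; exact: nbhs_right_gt.
rewrite -(@expRK R M) ler_ln ?posrE ?expR_gt0 ?invr_gt0//.
rewrite -[leLHS]invrK lef_pV2 ?posrE ?invr_gt0 ?expR_gt0//.
near: e; apply: nbhs_right_le; rewrite invr_gt0; exact: expR_gt0.
Unshelve. all: by end_near. Qed.

Lemma near_ln_natr_ge (M : R) : \forall m \near \oo, M <= ln (m%:R : R).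
Proof.
near=> m.
rewrite -(@expRK R M) ler_ln ?posrE ?expR_gt0//.
  near: m; exact: nbhs_infty_ger.
rewrite ltr0n; near: m; exact: nbhs_infty_gt.
Unshelve. all: by end_near. Qed.

Lemma cvg_divr_natr (c : R) : 0 < c -> (fun m : nat => c / m%:R) @ \oo --> (0 : R)^'+.
Proof.
move=> c0 A [e /= e0 eA].
change (\forall m \near \oo, A (c / m%:R)); near=> m.
have m0 : 0 < m%:R :> R.
  by rewrite ltr0n; near: m; exact: nbhs_infty_gt.
apply: eA => /=; last by rewrite divr_gt0.
rewrite sub0r normrN ger0_norm; last by rewrite divr_ge0// ltW.
rewrite ltr_pdivrMr// mulrC -ltr_pdivrMr//.
near: m; exact: nbhs_infty_gtr.
Unshelve. all: by end_near. Qed.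

Lemma cvg_truncn_divr (c : R) : 0 < c ->
  (fun e : R => Num.truncn (c / e)) @ 0^'+ --> \oo.
Proof.
move=> c0 A [N _ NA].
change (\forall e \near 0^'+, A (Num.truncn (c / e))); near=> e.
have e0 : 0 < e by near: e; exact: nbhs_right_gt.
apply: NA => /=; rewrite truncn_ge_nat; last by rewrite divr_ge0// ltW.
apply: (@le_trans _ _ N.+1%:R); first by rewrite ler_nat.
rewrite ler_pdivlMr// mulrC -ler_pdivlMr ?ltr0n//.
by near: e; apply: nbhs_right_le; rewrite divr_gt0 ?ltr0n.
Unshelve. all: by end_near. Qed.

End LogLimits.

(** * Passage to the limit in both inequalities *)

Theorem theorem1 (R : realType) (mu : probability (borel (unit_seq R)) R)
    (mu_inv : invariant_measure left_shift mu) :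
  lower_mrid left_shift distZ mu = lower_idr mu /\
  upper_mrid left_shift distZ mu = upper_idr mu.
Proof.
pose I := inf_entropy_rate left_shift (@distZ R) mu.
pose h m := entropy_rate left_shift mu (@cylinder_part R m).
have I0 e : (0 <= I e)%E by exact: inf_entropy_rate_ge0.
have h0 m : (0 < m)%N -> (0 <= h m)%E.
  move=> m0; apply: entropy_rate_ge0; first exact: left_shift_borel_map.
  exact: cylinder_partition.
have Ih m e : (0 < m)%N -> 8 <= m%:R * e -> (I e <= h m)%E.
  exact: inf_entropy_rate_le_cylinder.
have hI m e : (0 < m)%N -> m%:R * e <= 1 -> (h m <= I e + (ln 3)%:E)%E.
  exact: cylinder_le_inf_entropy_rate.
(* One constant for both errors: it exceeds the entropy gap $\ln 3$ and bounds the gaps between $\ln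
   m$ and $\ln(1/\epsilon)$. *)
pose C : R := ln 9.
have C0 : 0 < C by rewrite ln_gt0//; lra.
have ln3C : ln 3 <= C by rewrite /C ler_ln ?posrE//; lra.
have IhC m e : (0 < m)%N -> 8 <= m%:R * e -> (I e <= h m + C%:E)%E.
  by move=> m0 /(Ih _ _ m0)/le_trans; apply; rewrite leeDl// lee_fin ltW.
have hIC m e : (0 < m)%N -> m%:R * e <= 1 -> (h m <= I e + C%:E)%E.
  by move=> m0 /(hI _ _ m0)/le_trans; apply; rewrite leeD2l// lee_fin.
(* an upper bound [9 / e] on [m] costs only the constant [ln 9] *)
have lnle (a b : R) : 0 < a -> 0 < b -> a <= 9 * b -> ln a <= ln b + C.
  by move=> a0 b0 ab; rewrite addrC /C -lnM ?posrE// ler_ln ?posrE ?mulr_gt0.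
have trunc (c e : R) : 1 <= c -> 0 < e < 1 ->
    [/\ (0 < Num.truncn (c / e))%N, (Num.truncn (c / e))%:R * e <= c &
      c - e < (Num.truncn (c / e))%:R * e].
  move=> c1 /andP[e0 e1]; have ce : 1 <= c / e by rewrite ler_pdivlMr//; lra.
  have /truncn_itv/andP[t1 t2] : 0 <= c / e by apply: le_trans ce.
  split; first by rewrite truncn_gt0.
    by rewrite -ler_pdivlMr.
  rewrite ltr_pdivrMr// -natr1 mulrDl mul1r in t2; lra.
have idrE : (fun m => entropy_rate left_shift mu (cylinder_part m) *
    ((ln m%:R)^-1)%:E)%E = (fun m => ((ln m%:R)^-1)%:E * h m)%E.
  by apply/funext => m; rewrite muleC.
rewrite /lower_mrid /lower_idr /upper_mrid /upper_idr -/I idrE.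
have limnE (u : nat -> \bar R) : limn_einf u = limf_einf u \oo by [].
rewrite limnE /limn_esup.
split; apply/eqP; rewrite eq_le; apply/andP; split.
(* For lower limits the variable of the larger side is kept. Here $\epsilon=8/m$ gives $m\epsilon=8$
   exactly. *)
- have lim8 : (fun m : nat => 8 / m%:R) @ \oo --> (0 : R)^'+.
    exact: cvg_divr_natr.
  apply: (@le_limf_einf R R nat _ _ _ _ _ (fun m => 8 / m%:R)) => // d d0; near=> m.
  have m0 : 0 < m%:R :> R by rewrite ltr0n; near: m; exact: nbhs_infty_gt.
  apply: (@scaled_le _ _ _ C) => //.
  + by near: m; exact: (lim8 _ (near_ln_inv_ge _)).
  + by apply: lt_le_trans ltr01 _; near: m; exact: near_ln_natr_ge.
  + by apply: lnle; rewrite ?invr_gt0 ?divr_gt0// invf_div; lra.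
  + by apply: h0; rewrite -(@ltr0n R).
  + by apply: IhC; rewrite -?(@ltr0n R)// mulrC divfK// gt_eqF.
(* $m=\lfloor1/\epsilon\rfloor$ gives $m\epsilon\le1$; for $\epsilon<1/2$ also $m\epsilon>1/2$, so
   $1/\epsilon\le9m$. *)
- have limt : (fun e : R => Num.truncn (1 / e)) @ 0^'+ --> \oo.
    exact: cvg_truncn_divr.
  apply: (@le_limf_einf R nat R _ _ _ _ _ (fun e => Num.truncn (1 / e))) => // d d0.
  near=> e.
  have e0 : 0 < e by near: e; exact: nbhs_right_gt.
  have e1 : e < 2^-1 by near: e; apply: nbhs_right_lt.
  have [||m0 m1 m2] := trunc 1 e; rewrite ?lexx//; first by apply/andP; split; lra.
  apply: (@scaled_le _ _ _ C) => //.
  + by near: e; exact: (limt _ (near_ln_natr_ge _)).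
  + by apply: lt_le_trans ltr01 _; near: e; exact: near_ln_inv_ge.
  + move: m0 m2; set m := Num.truncn _ => m0 m2.
    by apply: lnle; rewrite ?invr_gt0 ?ltr0n// -div1r ler_pdivrMr//; lra.
  + exact: hIC.
(* For upper limits the variable of the smaller side is kept. Rounding $9/\epsilon$ down costs less
   than $\epsilon<1$ in $m\epsilon$, so $8<m\epsilon\le9$. *)
- have limt : (fun e : R => Num.truncn (9 / e)) @ 0^'+ --> \oo.
    exact: cvg_truncn_divr.
  apply: (@le_limf_esup R R nat _ _ _ _ _ (fun e => Num.truncn (9 / e))) => // d d0.
  near=> e.
  have e0 : 0 < e by near: e; exact: nbhs_right_gt.
  have e1 : e < 1 by near: e; apply: nbhs_right_lt.
  have [||m0 m1 m2] := trunc 9 e; rewrite ?e0//; first lra.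
  apply: (@scaled_le _ _ _ C) => //.
  + by near: e; exact: near_ln_inv_ge.
  + apply: lt_le_trans ltr01 _; near: e; exact: (limt _ (near_ln_natr_ge _)).
  + by apply: lnle; rewrite ?invr_gt0 ?ltr0n// ler_pdivlMr.
  + exact: h0.
  + by apply: IhC => //; lra.
(* $\epsilon=1/m$ gives $m\epsilon=1$ exactly, and the two logarithms coincide. *)
- have lim1 : (fun m : nat => 1 / m%:R) @ \oo --> (0 : R)^'+.
    exact: cvg_divr_natr.
  apply: (@le_limf_esup R nat R _ _ _ _ _ (fun m => 1 / m%:R)) => // d d0; near=> m.
  have m0 : 0 < m%:R :> R by rewrite ltr0n; near: m; exact: nbhs_infty_gt.
  apply: (@scaled_le _ _ _ C) => //.
  + by near: m; exact: near_ln_natr_ge.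
  + by apply: lt_le_trans ltr01 _; near: m; exact: (lim1 _ (near_ln_inv_ge _)).
  + by apply: lnle; rewrite ?invr_gt0 ?divr_gt0// invf_div; lra.
  + by apply: hIC; rewrite -?(@ltr0n R)// mulrC divfK// gt_eqF.
Unshelve. all: by end_near. Qed.
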